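(* Let $(\mathbb{C}^* )^k$ act quasi-symmetrically on $\mathbb{C}^N$ as in the context. For any $\delta\in\mathbb{R}^k$ and any GKZ chamber $C$, define $$C_{\nabla_\delta}=\bigcap_{p\in\nabla_\delta}(p+C)$$ and the skeleton for the GIT quotient in chamber $C$ $$\Lambda_C=\bigcup_{I\in\mathfrak{I}_C}(\mathbb{Z}^N+\mathbb{R}^I)\times\bigl(-(\mathbb{R}^\vee_{\ge 0})^{I^c}\bigr)\subset T^*\mathbb{R}^N,\qquad \mathfrak{I}_C=\{I\subset[N] : \mu_{\mathbb{R}}^{-1}(C)\cap\mathbb{R}^I_{>0}\neq\emptyset\}.$$ Then $\Lambda_{W_\delta}=\Lambda_C$ inside $\mu_{\mathbb{R}}^{-1}(C_{\nabla_\delta})$, i.e. the two sets have the same intersection with $T^*\bigl(\mu_{\mathbb{R}}^{-1}(C_{\nabla_\delta})\bigr)$. In particular, if $l\in C_{\nabla_\delta}\cap\mathbb{Z}^k$, then $\overline\Lambda_{\delta,l}\subset T^*T^n$ is the (non-equivariant) FLTZ skeleton mirror to the GIT quotient $\mathbb{C}^N/\!/_l(\mathbb{C}^* )^k$.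
   Context: Setting. $(\mathbb{C}^* )^k$ acts diagonally on $\mathbb{C}^N$, $n=N-k$, $[N]=\{1,\dots,N\}$. The action induces a surjection of character lattices $\mu_{\mathbb{Z}}:\mathbb{Z}^N\to\mathbb{Z}^k$ with kernel $\mathsf{M}\cong\mathbb{Z}^n$, and dually an exact sequence $0\to(\mathbb{Z}^k)^\vee\to(\mathbb{Z}^N)^\vee\xrightarrow{\nu_{\mathbb{Z}}}\mathsf{N}\to0$ with $\mathsf N=\mathsf M^\vee$. Write $\mu=\mu_{\mathbb{R}}$, $\nu_{\mathbb R}$ for the real extensions. Let $e_i$ be the standard basis of $\mathbb{Z}^N$, $e_i^\vee$ the dual basis, $\beta_i=\mu_{\mathbb{Z}}(e_i)\in\mathbb{Z}^k$; all $\beta_i$ are nonzero and they span $\mathbb{R}^k$. Quasi-symmetric: for every line $L\subset\mathbb{R}^k$ through $0$ containing some $\beta_i$, $\sum_{\beta_i\in L}\beta_i=0$. Windows. $\nabla=\frac12\sum_{i=1}^N[0,\beta_i]$ (Minkowski sum), $\nabla_\delta=\delta+\nabla$, $W_\delta=\nabla_\delta\cap\mathbb{Z}^k$. For $w\in\mathbb{Z}^N$, $\Lambda_w=SS(\mathbb{C}_{w+\mathbb{R}^N_{>0}})=\{(x,\xi)\in T^*\mathbb{R}^N:$ for each $i$, either $x_i>w_i,\ \xi_i=0$, or $x_i=w_i,\ \xi_i\le0\}$. Window skeleton: $\Lambda_{W_\delta}=\bigcup_{w\in\mu_{\mathbb{Z}}^{-1}(W_\delta)}\Lambda_w\subset T^*\mathbb{R}^N$.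 Fibres. For a submanifold $S\subset M$ and conical $\Lambda\subset T^*M$, $\Lambda|_S$ is the image of $\Lambda\cap T^*M|_S$ in $(T^*M|_S)/T^*_SM\cong T^*S$. For $l\in\mathbb{R}^k$, $X_l=\mu_{\mathbb{R}}^{-1}(l)\cong\mathbb{R}^n$, $\Lambda_{\delta,l}=\Lambda_{W_\delta}|_{X_l}$, and $\overline\Lambda_{\delta,l}=\Lambda_{\delta,l}/\mathsf{M}\subset T^*(X_l/\mathsf{M})\cong T^*T^n$, where $T^n=(\mathbb{R}/\mathbb{Z})^n$ and $\mathsf{M}$ acts by translation. For $l\in \mathbb Z^k$, $X_l$ is identified with $\mathsf M_{\mathbb R}$ by choosing a lift $\tilde l\in\mu_{\mathbb Z}^{-1}(l)$ as origin; the identification of $X_l/\mathsf M$ with $\mathsf M_{\mathbb R}/\mathsf M=T^n$ does not depend on the lift. GKZ chambers. $\mathbb{R}^I=\mathrm{span}(e_i:i\in I)$, $\mathbb{R}^I_{>0}=\{\sum_{i\in I}a_ie_i:a_i>0\}$, $I^c=[N]\setminus I$, $(\mathbb{R}^\vee_{\ge0})^{I^c}=\mathrm{cone}(e_i^\vee:i\in I^c)$. The images under $\mu_{\mathbb{R}}$ of the faces of $\mathbb{R}^N_{\ge0}$ and their intersections induce the GKZ fan in $\mathbb{R}^k$; a GKZ chamber is the interior of a top-dimensional cone of it. FLTZ skeleton. For a chamber $C$, the GIT quotient $\mathbb C^N/\!/_l(\mathbb C^* )^k$ for $l\in C$ is the toric stack of the stacky fan in $\mathsf N_{\mathbb R}$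 with cones $\bar\sigma_{I^c}=\nu_{\mathbb R}(\mathrm{cone}(e_i^\vee:i\in I^c))$, $I\in\mathfrak I_C$, and ray vectors $\alpha_i=\nu_{\mathbb Z}(e_i^\vee)$. Its non-equivariant FLTZ skeleton is the quotient by $\mathsf M$ of $\bigcup_{I\in\mathfrak I_C}\{\bar x\in\mathsf M_{\mathbb R}:\langle\bar x,\alpha_i\rangle\in\mathbb Z\ \forall i\in I^c\}\times(-\bar\sigma_{I^c})\subset\mathsf M_{\mathbb R}\times\mathsf N_{\mathbb R}=T^*\mathsf M_{\mathbb R}$.
   Formalization: In the last sentence the GIT quotient is taken to be the one for the chamber C rather than for l itself; the two agree when l lies in C, but for large δ a point l of C_{∇_δ} can lie outside C, where the literal claim fails. *)

(* Defs.v *)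
From HB Require Import structures.
From mathcomp Require Import all_boot all_order all_algebra.
From mathcomp Require Import all_classical all_reals all_analysis.

Set Implicit Arguments.
Unset Strict Implicit.
Unset Printing Implicit Defensive.

Import Order.TTheory GRing.Theory Num.Theory.
Import numFieldNormedType.Exports.

Local Open Scope classical_set_scope.
Local Open Scope ring_scope.

(* Vectors are row vectors.  The action of (C^* )^k on C^N is encoded by its
   weight matrix beta : 'M[int]_(N, k), whose i-th row is the weight beta_i.
   Covectors in (R^N)^vee are given by their coordinates in the dual basis
   e_i^vee, so T^*R^N is the type 'rV[R]_N * 'rV[R]_N of pairs (x, xi). *)

Definition toR (R : realType) (m n : nat) (A : 'M[int]_(m, n)) : 'M[R]_(m, n) :=
  map_mx intr A.

Definition Ztuple (R : realType) (N : nat) : set 'rV[R]_N :=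
  range (@toR R 1 N).

Definition segment0 (R : realType) (k : nat) (b : 'rV[R]_k) : set 'rV[R]_k :=
  [set t *: b | t in [set t : R | 0 <= t <= 1]].

Definition translate (R : realType) (k : nat) (p : 'rV[R]_k) (A : set 'rV[R]_k)
    : set 'rV[R]_k :=
  [set p + x | x in A].

Section Coordinates.
Variables (R : realType) (N : nat).
Implicit Type I : {set 'I_N}.

Definition comb I (a : 'I_N -> R) : 'rV[R]_N :=
  \sum_(i in I) a i *: delta_mx 0 i.

Definition RI I : set 'rV[R]_N := range (comb I).

Definition RIpos I : set 'rV[R]_N :=
  [set comb I a | a in [set a | forall i, i \in I -> 0 < a i]].

(* cone(e_i : i in I), or cone(e_i^vee : i in I) when read in (R^N)^vee *)
Definition RInneg I : set 'rV[R]_N :=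
  [set comb I a | a in [set a | forall i, i \in I -> 0 <= a i]].

(* T^*U for U open in R^N *)
Definition cotangent (U : set 'rV[R]_N) : set ('rV[R]_N * 'rV[R]_N) :=
  [set z | U z.1].

End Coordinates.

Section Action.
Variables (N k : nat) (beta : 'M[int]_(N, k)).

Definition muZ (w : 'rV[int]_N) : 'rV[int]_k := w *m beta.

Section Real.
Variable R : realType.

Definition muR (x : 'rV[R]_N) : 'rV[R]_k := x *m toR R beta.

Definition betaR (i : 'I_N) : 'rV[R]_k := row i (toR R beta).

(* The lines through 0 are the row spaces of the nonzero v : 'rV[R]_k. *)
Definition quasi_symmetric : Prop :=
  forall v : 'rV[R]_k, v != 0 ->
    (exists i, (betaR i <= v)%MS) ->
    \sum_(i | (betaR i <= v)%MS) betaR i = 0.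

Definition nabla : set 'rV[R]_k :=
  [set 2^-1 *: \sum_i p i
    | p in [set p : 'I_N -> 'rV[R]_k | forall i, segment0 (betaR i) (p i)]].

Definition nabla_at (delta : 'rV[R]_k) : set 'rV[R]_k := translate delta nabla.

Definition window (delta : 'rV[R]_k) : set 'rV[int]_k :=
  [set chi | nabla_at delta (toR R chi)].

Definition Lambda_pt (w : 'rV[int]_N) : set ('rV[R]_N * 'rV[R]_N) :=
  [set z : 'rV[R]_N * 'rV[R]_N |
    forall i, ((w 0 i)%:~R < z.1 0 i /\ z.2 0 i = 0)
           \/ (z.1 0 i = (w 0 i)%:~R /\ z.2 0 i <= 0)].

Definition Lambda_window (delta : 'rV[R]_k) : set ('rV[R]_N * 'rV[R]_N) :=
  \bigcup_(w in muZ @^-1` window delta) Lambda_pt w.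

Definition face_image (I : {set 'I_N}) : set 'rV[R]_k := muR @` RInneg I.

(* The cone of the GKZ fan having theta in its relative interior: the fan is
   the common refinement of the images of the faces of the orthant. *)
Definition gkz_cone (theta : 'rV[R]_k) : set 'rV[R]_k :=
  \bigcap_(I in [set I | face_image I theta]) face_image I.

Definition gkz_fan : set (set 'rV[R]_k) :=
  [set gkz_cone theta | theta in face_image [set: 'I_N]%SET].

Definition top_dimensional (sigma : set 'rV[R]_k) : Prop :=
  exists2 B : 'M[R]_k, B \in unitmx & forall j, sigma (row j B).

Definition gkz_chamber (C : set 'rV[R]_k) : Prop :=
  exists sigma, [/\ gkz_fan sigma, top_dimensional sigma & C = sigma^°].

Definition chamber_core (delta : 'rV[R]_k) (C : set 'rV[R]_k) : set 'rV[R]_k :=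
  \bigcap_(p in nabla_at delta) translate p C.

Definition index_sets (C : set 'rV[R]_k) : set {set 'I_N} :=
  [set I | (muR @^-1` C) `&` RIpos I !=set0].

Definition Lambda_chamber (C : set 'rV[R]_k) : set ('rV[R]_N * 'rV[R]_N) :=
  \bigcup_(I in index_sets C)
    ([set w + y | w in @Ztuple R N & y in RI I]
       `*` [set - xi | xi in RInneg (~: I)%SET]).

Definition MR : {vspace 'rV[R]_N} := lker (linfun (mulmxr (toR R beta))).

Lemma mem_MR (x : 'rV[R]_N) : (x \in MR) = (muR x == 0).
Proof. by rewrite memv_ker lfunE. Qed.

(* N_R = (M_R)^vee *)
Definition NR := 'Hom(subvs_of MR, R^o).

Definition pairing (xi : 'rV[R]_N) (x : subvs_of MR) : R^o :=
  \sum_i xi 0 i * vsval x 0 i.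

Lemma pairing_is_linear xi : linear (pairing xi).
Proof.
move=> a x y; rewrite /pairing scaler_sumr -big_split /=.
apply: eq_bigr => i _.
by rewrite !mxE mulrDr mulrCA.
Qed.

HB.instance Definition _ xi :=
  GRing.isLinear.Build R (subvs_of MR) R^o _ (pairing xi) (pairing_is_linear xi).

(* nu_R, the dual of the inclusion of M_R: restriction of covectors to M_R *)
Definition nuR (xi : 'rV[R]_N) : NR := linfun (pairing xi).

Lemma nuRE xi x : nuR xi x = \sum_i xi 0 i * vsval x 0 i.
Proof. by rewrite lfunE. Qed.

(* alpha_i = nu_Z(e_i^vee), as an element of N_R *)
Definition alpha (i : 'I_N) : NR := nuR (delta_mx 0 i).

(* M = ker mu_Z, as the lattice of integral vectors of M_R *)
Definition M_pred : {pred subvs_of MR} :=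
  fun x => vsval x \is a mxOver Num.int.

Lemma M_predP (x : subvs_of MR) :
  reflect (exists2 m : 'rV[int]_N, muZ m = 0 & vsval x = toR R m) (M_pred x).
Proof.
apply: (iffP idP) => [/mxOverP xZ | [m _ xE]]; last first.
  by rewrite /M_pred xE; apply/mxOverP => i j; rewrite mxE intr_int.
pose m : 'rV[int]_N := \row_j Num.floor (vsval x 0 j).
have xE : vsval x = toR R m.
  by apply/rowP => j; rewrite !mxE floorK ?xZ.
exists m => //; have := subvsP x.
rewrite mem_MR xE /muR /toR -map_mxM => /eqP /matrixP m0.
apply/matrixP => i j; have := m0 i j; rewrite !mxE => /eqP.
by rewrite intr_eq0 => /eqP.
Qed.

Lemma M_zmod_closed : zmod_closed M_pred.
Proof.
split=> [|x y /mxOverP xM /mxOverP yM]; apply/mxOverP=> i j; rewrite mxE.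
- exact: rpred0.
- by rewrite mxE rpredB.
Qed.

HB.instance Definition _ :=
  GRing.isZmodClosed.Build (subvs_of MR) M_pred M_zmod_closed.

(* T^n = M_R / M *)
Definition torus := Quotient.quot M_pred.

Definition mod_M (L : set (subvs_of MR * NR)) : set (torus * NR) :=
  [set (\pi_torus z.1, z.2)%qT | z in L].

(* The restriction L|_{X_l}.  X_l = mu_R^{-1}(l) is an affine space directed by
   M_R, so T^*X_l is X_l x N_R, and the quotient of T^*R^N|_{X_l} by the
   conormal bundle of X_l is the restriction of covectors to M_R. *)
Definition restr_fibre (L : set ('rV[R]_N * 'rV[R]_N)) (l : 'rV[R]_k)
    : set ('rV[R]_N * NR) :=
  [set (z.1, nuR z.2) | z in L `&` [set z | muR z.1 = l]].

Definition Lambda_fibre (delta l : 'rV[R]_k) : set ('rV[R]_N * NR) :=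
  restr_fibre (Lambda_window delta) l.

(* The quotient of Lambda_{delta, l} by M for an integral l, as a subset of
   T^*T^n: X_l is identified with M_R by taking the lift w0 of l as origin. *)
Definition Lambda_bar (delta : 'rV[R]_k) (l : 'rV[int]_k) (w0 : 'rV[int]_N)
    : set (torus * NR) :=
  mod_M [set z : subvs_of MR * NR |
    Lambda_fibre delta (toR R l) (toR R w0 + vsval z.1, z.2)].

Definition sigma_bar (J : {set 'I_N}) : set NR := nuR @` RInneg J.

Definition FLTZ_cover (C : set 'rV[R]_k) : set (subvs_of MR * NR) :=
  \bigcup_(I in index_sets C)
    ([set x | forall i, i \in (~: I)%SET -> (alpha i x : R) \is a Num.int]
       `*` [set - eta | eta in sigma_bar (~: I)%SET]).

Definition FLTZ (C : set 'rV[R]_k) : set (torus * NR) := mod_M (FLTZ_cover C).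

End Real.
End Action.

Arguments muR {N k} beta {R} x.
Arguments Lambda_bar {N k} beta {R} delta l w0 _.
Arguments FLTZ {N k} beta {R} C _.

(* Main.v *)
(* Covectors aside, the inclusion of the chamber skeleton in the window skeleton
   asks, for [I] with [mu(R^I_{>0})] meeting [C] and [x] integral off [I], for an
   integral [w <= x] that agrees with [x] off [I] and has weight in the zonotope
   [nabla_delta].  Choose [w] with [mu w] nearest to [nabla_delta], let [p] be the
   nearest point and [l = mu w - p], and suppose [l <> 0].  Quasi-symmetry allows
   [mu w] and [p] to be translated together by [beta_i] against [l]; the new pair
   is still nearest with the same [l], although [l] takes a smaller value at the
   new [p], contradicting that [p] maximises [l].  So no such move is admissible:
   [l.beta_i <= 0] on [I], with [x_i - w_i < 1] when it is negative.  Since [C]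
   lies in the cone spanned by [beta_i], [i] in [I], the form [l] is nonpositive
   on [C], hence on [mu x - nabla_delta], and this contradicts the lower bound on
   [l.(mu x - mu w)] given by the admissibility constraints. *)

Require Import Defs.
From HB Require Import structures.
From mathcomp Require Import all_boot all_order all_algebra.
From mathcomp Require Import all_classical all_reals all_analysis.
From mathcomp Require Import zify ring lra.

Set Implicit Arguments.
Unset Strict Implicit.
Unset Printing Implicit Defensive.

Import Order.TTheory GRing.Theory Num.Theory.
Import numFieldNormedType.Exports.

Local Open Scope classical_set_scope.
Local Open Scope ring_scope.

(** * Euclidean inner product, also used to represent linear forms by vectors *)

Definition dot (R : realFieldType) (k : nat) (u v : 'rV[R]_k) : R :=
  \sum_j u 0 j * v 0 j.

Section DotProduct.
Variables (R : realFieldType) (k : nat).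
Implicit Types u v w : 'rV[R]_k.

Lemma dotC u v : dot u v = dot v u.
Proof. by apply: eq_bigr => j _; rewrite mulrC. Qed.

Lemma dotDr u v w : dot u (v + w) = dot u v + dot u w.
Proof. by rewrite -big_split; apply: eq_bigr => j _; rewrite mxE mulrDr. Qed.

Lemma dotZr a u v : dot u (a *: v) = a * dot u v.
Proof. by rewrite mulr_sumr; apply: eq_bigr => j _; rewrite mxE mulrCA. Qed.

Lemma dotNr u v : dot u (- v) = - dot u v.
Proof. by rewrite -scaleN1r dotZr mulN1r. Qed.

Lemma dotBr u v w : dot u (v - w) = dot u v - dot u w.
Proof. by rewrite dotDr dotNr. Qed.

Lemma dotZl a u v : dot (a *: v) u = a * dot v u.
Proof. by rewrite !(dotC _ u) dotZr. Qed.

Lemma dotBl u v w : dot (v - w) u = dot v u - dot w u.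
Proof. by rewrite !(dotC _ u) dotBr. Qed.

Lemma dot0r u : dot u 0 = 0.
Proof. by rewrite -(scale0r (0 : 'rV_k)) dotZr mul0r. Qed.

Lemma dot_sumr (I : Type) (s : seq I) (P : pred I) (F : I -> 'rV[R]_k) u :
  dot u (\sum_(i <- s | P i) F i) = \sum_(i <- s | P i) dot u (F i).
Proof.
by elim/big_rec2: _ => [|i x y _ <-]; [exact: dot0r | exact: dotDr].
Qed.

Lemma dot_ge0 u : 0 <= dot u u.
Proof. by apply: sumr_ge0 => j _; rewrite -expr2 sqr_ge0. Qed.

Lemma dot_gt0 u : u != 0 -> 0 < dot u u.
Proof.
move=> u0; rewrite lt_neqAle dot_ge0 andbT eq_sym; apply: contra_neq u0.
move=> /psumr_eq0P u0; apply/rowP => j; rewrite mxE.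
by apply/eqP; rewrite -sqrf_eq0 expr2 u0 // => i _; rewrite -expr2 sqr_ge0.
Qed.

Lemma sqr_coord_le_dot u j : u 0 j ^+ 2 <= dot u u.
Proof.
rewrite /dot (bigD1 j) //= expr2 lerDl; apply: sumr_ge0 => i _.
by rewrite -expr2 sqr_ge0.
Qed.

Lemma dot_sqrB s u v :
  dot (u - s *: v) (u - s *: v)
  = dot u u - 2 * s * dot u v + s ^+ 2 * dot v v.
Proof. by rewrite dotBl !dotBr !dotZl !dotZr (dotC v u); ring. Qed.

End DotProduct.

Lemma dot_row_mx (R : realFieldType) (m n : nat) (u u' : 'rV[R]_m)
    (v v' : 'rV[R]_n) :
  dot (row_mx u v) (row_mx u' v') = dot u u' + dot v v'.
Proof.
rewrite /dot big_split_ord /=.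
by congr (_ + _); apply: eq_bigr => j _; rewrite ?row_mxEl ?row_mxEr.
Qed.

(** * Linear inequalities: Farkas' lemma, linear programming duality, forms at interior points *)

(* Induction on the number of generators: if the separating form [d] of the
   tail is positive on the new generator [a i], project along [a i] onto the
   kernel of [d] and use the induction hypothesis there. *)
Lemma farkas_seq (R : realFieldType) (I : eqType) (k : nat) (s : seq I)
    (a : I -> 'rV[R]_k) (b : 'rV[R]_k) : uniq s ->
  (exists2 y : I -> R, forall i, 0 <= y i & b = \sum_(i <- s) y i *: a i) \/
  (exists2 d, forall i, i \in s -> dot d (a i) <= 0 & 0 < dot d b).
Proof.
elim: s a b => [|i0 s IHs] a b.
  move=> _; have [->|b0] := eqVneq b 0.
    by left; exists (fun=> 0) => //; rewrite big_nil.
  by right; exists b => //; exact: dot_gt0.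
move=> /andP[i0s us].
have extend (z : R) (y : I -> R) (F : I -> 'rV[R]_k) :
    \sum_(i <- i0 :: s) (if i == i0 then z else y i) *: F i
    = z *: F i0 + \sum_(i <- s) y i *: F i.
  rewrite big_cons eqxx; congr (_ + _); apply: eq_big_seq => i si.
  by case: eqP i0s => // <-; rewrite si.
have [[y y0 yE]|[d ds db]] := IHs a b us.
  left; exists (fun i => if i == i0 then 0 else y i).
    by move=> i; case: ifP.
  by rewrite extend scale0r add0r.
have [di0|di0] := leP (dot d (a i0)) 0.
  right; exists d => // i; rewrite inE => /predU1P[->//|]; exact: ds.
pose r x := dot d x / dot d (a i0).
pose pr x := x - r x *: a i0.
have [[y y0 yE]|[d' d's d'b]] := IHs (pr \o a) (pr b) us.
  (* The coefficient of [a i0] collects what the projection removed. It is nonnegative because [d]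
     is positive on [b] and nonpositive on the tail. *)
  left; exists (fun i =>
    if i == i0 then r b - \sum_(j <- s) y j * r (a j) else y i).
    move=> i; case: ifP => // _; rewrite subr_ge0.
    apply: (@le_trans _ _ 0); last by rewrite divr_ge0 // ltW.
    rewrite big_seq; apply: sumr_le0 => j js.
    by rewrite mulr_ge0_le0 // pmulr_lle0 ?invr_gt0 // ds.
  rewrite extend scalerBl scaler_suml -addrA [- _ + _]addrC -sumrB.
  have -> : \sum_(i <- s) (y i *: a i - (y i * r (a i)) *: a i0) = pr b.
    by rewrite yE; apply: eq_bigr => i _; rewrite scalerBr scalerA.
  by rewrite addrC subrK.
(* This is [d'] composed with the projection [pr], so it vanishes on [a i0]. *)
pose d'' := d' - (dot d' (a i0) / dot d (a i0)) *: d.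
have d''E x : dot d'' x = dot d' (pr x).
  rewrite dotBl dotZl dotBr dotZr /r; field; exact: lt0r_neq0.
right; exists d''; last by rewrite d''E.
move=> i; rewrite inE => /predU1P[->|]; last by rewrite d''E; exact: d's.
by rewrite d''E /pr /r divff ?lt0r_neq0 // scale1r subrr dot0r.
Qed.

Lemma farkas (R : realFieldType) (I : finType) (k : nat)
    (a : I -> 'rV[R]_k) (b : 'rV[R]_k) :
  (exists2 y : I -> R, forall i, 0 <= y i & b = \sum_i y i *: a i) \/
  (exists2 d, forall i, dot d (a i) <= 0 & 0 < dot d b).
Proof.
have [[y y0 yE]|[d da db]] := farkas_seq a b (index_enum_uniq I).
  by left; exists y.
by right; exists d => // i; apply: da; rewrite mem_index_enum.
Qed.

(** Farkas' lemma is applied twice to generators lengthened by their cost: once to show that the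
    infimum [t] of the primal costs is attained, once to produce a dual form reaching the value
    [t]. *)
Lemma lp_duality (R : realType) (I : finType) (k : nat)
    (a : I -> 'rV[R]_k) (c : I -> R) (b : 'rV[R]_k) :
  (forall i, 0 <= c i) ->
  (exists2 y : I -> R, forall i, 0 <= y i & b = \sum_i y i *: a i) ->
  exists (y : I -> R) (d : 'rV[R]_k),
    [/\ forall i, 0 <= y i, b = \sum_i y i *: a i,
        forall i, dot d (a i) <= c i & \sum_i y i * c i <= dot d b].
Proof.
move=> c0 [y1 y10 y1E].
pose S := [set \sum_i y i * c i |
  y in [set y : I -> R | (forall i, 0 <= y i) /\ b = \sum_i y i *: a i]].
have S0 : S !=set0 by exists (\sum_i y1 i * c i); exists y1.
have lbS : lbound S 0.
  by move=> _ [y [y0 _] <-]; apply: sumr_ge0 => i _; rewrite mulr_ge0.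
have hS : has_inf S by split=> //; exists 0.
pose t := inf S.
have tS x : S x -> t <= x by apply: ge_inf; exists 0.
pose A (z : 'rV[R]_k) (s : R) : 'rV[R]_(k + 1) := row_mx z (const_mx s).
have dot1 (s s' : R) : dot (const_mx s : 'rV_1) (const_mx s') = s * s'.
  by rewrite /dot big_ord1 !mxE.
have dotA (d : 'rV[R]_(k + 1)) z s :
    dot d (A z s) = dot (lsubmx d) z + rsubmx d 0 0 * s.
  rewrite -{1}(hsubmxK d) dot_row_mx -dot1; congr (_ + dot _ _).
  by apply/rowP => j; rewrite !ord1 [RHS]mxE.
have sumA (J : finType) (z : J -> 'rV_k) (s y : J -> R) :
    \sum_i y i *: A (z i) (s i) = A (\sum_i y i *: z i) (\sum_i y i * s i).
  have h u v (f : R) : f *: A u v = A (f *: u) (f * v).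
    by rewrite /A scale_row_mx; congr row_mx; apply/rowP => j; rewrite !mxE.
  under eq_bigr do rewrite h.
  rewrite /A; elim/big_rec3: _ => [|i x u w _ ->].
    by rewrite -[LHS](row_mx0 _ 1) //; congr row_mx; apply/rowP=> j; rewrite !mxE.
  by rewrite add_row_mx; congr row_mx; apply/rowP => j; rewrite !mxE.
have Ainj z s z' s' : A z s = A z' s' -> z = z' /\ s = s'.
  move=> /eq_row_mx[-> /rowP/(_ 0)]; rewrite !mxE; by split.
(* If [(b, t)] were outside the cone, the separating form would have a negative cost coordinate and
   would exclude costs close to [t], although [t] is an infimum. *)
have [[y y0]|[d da]] := farkas (fun i => A (a i) (c i)) (A b t); last first.
  rewrite dotA => db.
  have dS x : S x -> dot (lsubmx d) b + rsubmx d 0 0 * x <= 0.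
    move=> [y [y0 bE] <-]; rewrite -dotA bE -sumA dot_sumr.
    by apply: sumr_le0 => i _; rewrite dotZr mulr_ge0_le0.
  have [x Sx xt] : exists2 x, S x & x < t - (dot (lsubmx d) b + rsubmx d 0 0 * t) / rsubmx d 0 0.
    have [x1 Sx1] := S0.
    have r0 : rsubmx d 0 0 < 0.
      have := dS _ Sx1; have := tS _ Sx1 => h1 h2; nra.
    rewrite -mulrN -invrN; apply: inf_adherent => //.
    by rewrite divr_gt0 // oppr_gt0.
  have := dS _ Sx; have := tS _ Sx => tx h2.
  have r0 : rsubmx d 0 0 < 0 by nra.
  move: xt; rewrite -ltrBlDl ltrNr ltr_ndivrMr // => xt.
  by clear -xt h2; lra.
rewrite sumA => /Ainj[yE yt].
pose z1 (i : I + unit) := if i is inl i then a i else - b.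
pose s1 (i : I + unit) := if i is inl i then c i else - t.
(* A form separating [(0, -1)] has a negative cost coordinate; dividing by its absolute value gives
   the dual solution. If none exists, the resulting combination either has negative cost outright
   ([s0 = 0]) or, after division by [s0], represents [b] at a cost below [t]. *)
have [[z z0 zE]|[d da]] := farkas (fun i => A (z1 i) (s1 i)) (A 0 (-1)); last first.
  rewrite dotA dot0r add0r mulrN1 oppr_gt0 => r0.
  exists y, ((- rsubmx d 0 0)^-1 *: lsubmx d); split => //.
    move=> i; rewrite dotZl mulrC ler_pdivrMr ?oppr_gt0 //.
    by have := da (inl i); rewrite /= dotA /= => h; clear -h; lra.
  rewrite -yt dotZl mulrC ler_pdivlMr ?oppr_gt0 //.
  by have := da (inr tt); rewrite /= dotA dotNr /= => h; clear -h; lra.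
exfalso; move: zE; rewrite sumA => /Ainj[].
rewrite !big_sumType /= (big_pred1 tt) ?(big_pred1 tt); do ?by case.
set s0 := z (inr tt) => /eqP; rewrite eq_sym scalerN subr_eq0 => /eqP bE tE.
have s00 : 0 <= s0 by exact: z0.
have [s0E|s0N] := eqVneq s0 0.
  move: tE; rewrite s0E mul0r addr0 => tE.
  have : 0 <= \sum_i z (inl i) * c i by apply: sumr_ge0 => i _; rewrite mulr_ge0.
  by rewrite -tE ler0N1.
have s0P : 0 < s0 by rewrite lt_def s0N.
suff : t <= (\sum_i z (inl i) * c i) / s0.
  by rewrite ler_pdivlMr // => h; clear -h tE; lra.
apply: tS; exists (fun i => z (inl i) / s0).
  split=> [i|]; first by rewrite divr_ge0.
  rewrite -[LHS]scale1r -(mulVf s0N) -scalerA -bE scaler_sumr.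
  by apply: eq_bigr => i _; rewrite scalerA mulrC.
by rewrite mulr_suml; apply: eq_bigr => i _; rewrite mulrAC.
Qed.

(** A small move from [x] in the direction [- d] stays in [A], yet makes the form negative unless
    [d = 0]. *)
Lemma interior_dot_eq0 (R : realType) (k : nat) (A : set 'rV[R]_k)
    (d x : 'rV[R]_k) :
  A° x -> (forall z, A z -> 0 <= dot d z) -> dot d x = 0 -> d = 0.
Proof.
move=> Ax A0 dx; apply/eqP; apply: contraT => /dot_gt0 d0.
have cf : (fun e : R => x - e *: d) @ (0 : R) --> x - 0 *: d.
  by apply: cvgB; [exact: cvg_cst | apply: cvgZr_tmp; exact: cvg_id].
rewrite scale0r subr0 in cf.
have := cf _ Ax => /= /nbhs_ballP[e /= e0] /(_ (e / 2)) Ae.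
have : A (x - (e / 2) *: d).
  by apply: Ae; rewrite /ball /= sub0r normrN gtr0_norm ?divr_gt0 //; lra.
move=> /A0; rewrite dotBr dotZr dx; nra.
Qed.

(** * Coordinate subspaces and cones *)

Section Coordinates.
Variables (R : realType) (N : nat).
Implicit Types (I : {set 'I_N}) (x : 'rV[R]_N).

Lemma combE I (a : 'I_N -> R) i : comb I a 0 i = if i \in I then a i else 0.
Proof.
rewrite /comb summxE; under eq_bigr do rewrite !mxE /=.
case: ifPn => [iI|iI].
  rewrite (bigD1 i) //= !eqxx mulr1 big1 ?addr0 // => j /andP[_ ji].
  by rewrite eq_sym (negPf ji) mulr0.
rewrite big1 // => j jI; case: eqP iI => [->|]; last by rewrite mulr0.
by rewrite jI.
Qed.

Lemma comb_coord I x : (forall i, i \notin I -> x 0 i = 0) ->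
  comb I (fun i => x 0 i) = x.
Proof. by move=> x0; apply/rowP => i; rewrite combE; case: ifPn => // /x0. Qed.

Lemma RIE I x : RI I x <-> (forall i, i \notin I -> x 0 i = 0).
Proof.
split=> [[a _ <-] i iI|x0]; first by rewrite combE (negPf iI).
by exists (fun i => x 0 i) => //; exact: comb_coord.
Qed.

Lemma RIposE I x : RIpos I x <->
  (forall i, i \in I -> 0 < x 0 i) /\ (forall i, i \notin I -> x 0 i = 0).
Proof.
split=> [[a a0 <-]|[x0 xI]].
  by split=> i iI; rewrite combE; [rewrite iI a0 | rewrite (negPf iI)].
by exists (fun i => x 0 i) => //; exact: comb_coord.
Qed.

Lemma RInnegE I x : RInneg I x <->
  (forall i, i \in I -> 0 <= x 0 i) /\ (forall i, i \notin I -> x 0 i = 0).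
Proof.
split=> [[a a0 <-]|[x0 xI]].
  by split=> i iI; rewrite combE; [rewrite iI a0 | rewrite (negPf iI)].
by exists (fun i => x 0 i) => //; exact: comb_coord.
Qed.

End Coordinates.

(** * Weights and linear forms on GKZ chambers *)

Section Weights.
Variables (R : realType) (N k : nat) (beta : 'M[int]_(N, k)).

Lemma muR_sum (x : 'rV[R]_N) : muR beta x = \sum_i x 0 i *: betaR beta R i.
Proof. exact: mulmx_sum_row. Qed.

Lemma toR_muZ (w : 'rV[int]_N) : toR R (muZ beta w) = muR beta (toR R w).
Proof. exact: map_mxM. Qed.

(* Linear programming duality, for the cost [max 0 (dot d (betaR i))], yields a
   cone of the GKZ arrangement containing [theta] on which the optimal value is
   a linear form.  This value is nonnegative and vanishes at the interior point
   [muR beta y], hence it vanishes identically; it dominates [dot d]. *)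
Lemma chamber_dot_le0 (C : set 'rV[R]_k) (y : 'rV[R]_N) (d : 'rV[R]_k) :
  gkz_chamber beta C -> C (muR beta y) ->
  (forall i, 0 <= y 0 i) ->
  (forall i, y 0 i != 0 -> dot d (betaR beta R i) <= 0) ->
  forall x, C x -> dot d x <= 0.
Proof.
move=> [_ [[theta [a /RInnegE[a0 _] thetaE] <-] _ ->]] Cy y0 dy x Cx.
pose c i := Num.max 0 (dot d (betaR beta R i)).
have c0 i : 0 <= c i by rewrite le_max lexx.
have [|z [d' [z0 zE d'c zd']]] := @lp_duality R 'I_N k (betaR beta R) c theta c0.
  by exists (a 0) => [i|]; [rewrite a0 ?inE | rewrite -thetaE muR_sum].
pose J := [set i | z i != 0]%SET.
have thetaJ : face_image beta J theta.
  exists (comb J z); first by exists z.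
  rewrite muR_sum zE; apply: eq_bigr => i _; rewrite combE inE.
  by case: eqP => //= ->.
(* Complementary slackness: the dual constraints are tight on the support of the optimal [z]. *)
have d'J i : i \in J -> dot d' (betaR beta R i) = c i.
  rewrite inE => zi; apply/eqP; rewrite eq_le d'c /=.
  have zi0 : 0 < z i by rewrite lt_def zi z0.
  have h : 0 <= \sum_(j | j != i) z j * (c j - dot d' (betaR beta R j)).
    by apply: sumr_ge0 => j _; rewrite mulr_ge0 // subr_ge0.
  have : \sum_j z j * (c j - dot d' (betaR beta R j)) <= 0.
    under eq_bigr do rewrite mulrBr.
    rewrite sumrB subr_le0 (le_trans zd') // zE dot_sumr.
    by under eq_bigr do rewrite dotZr.
  rewrite (bigD1 i) //= => h'; have : z i * (c i - dot d' (betaR beta R i)) <= 0.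
    lra.
  by rewrite pmulr_rle0 // subr_le0.
have GJ u : gkz_cone beta theta u -> 0 <= dot d' u /\ dot d u <= dot d' u.
  move=> /(_ J thetaJ)[v /RInnegE[v0 vJ] <-].
  rewrite muR_sum !dot_sumr; split; [apply: sumr_ge0 | apply: ler_sum] => i _;
    rewrite !dotZr; have [iJ|/vJ->] := boolP (i \in J); rewrite ?mul0r //.
    by rewrite d'J // mulr_ge0 ?v0.
  by rewrite d'J // ler_wpM2l ?v0 // le_max lexx orbT.
have Cxy := interior_subset Cy; have [d'y _] := GJ _ Cxy.
(* On the support of [y] the cost [c] vanishes, so [d'] is nonpositive at [muR beta y], while it is
   nonnegative on the whole GKZ cone. *)
have d'0 : d' = 0.
  apply: (interior_dot_eq0 Cy) => [u /GJ[]//|].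
  apply/eqP; rewrite eq_le d'y andbT muR_sum dot_sumr.
  apply: sumr_le0 => i _; rewrite dotZr.
  have [->|yi] := eqVneq (y 0 i) 0; first by rewrite mul0r.
  rewrite mulr_ge0_le0 //; apply: le_trans (d'c i) _.
  by rewrite ge_max lexx dy.
have [_] := GJ _ (interior_subset Cx).
by rewrite d'0 (dotC 0) dot0r.
Qed.

(** The weights are grouped by the line they span, and each group sums to zero by quasi-symmetry.
    Since no weight vanishes, membership in the line of another weight is symmetric, so the groups
    partition the indices. *)
Lemma sum_betaR_eq0 : (forall i, row i beta != 0) -> quasi_symmetric beta R ->
  \sum_i betaR beta R i = 0.
Proof.
move=> beta0 qs.
pose l i := [set j | (betaR beta R j <= betaR beta R i)%MS]%SET.
have b0 i : betaR beta R i != 0.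
  apply: contra_neq (beta0 i) => /rowP bi; apply/rowP => j.
  by have := bi j; rewrite !mxE => /eqP; rewrite intr_eq0 => /eqP.
have sub i j : (betaR beta R j <= betaR beta R i)%MS ->
    (betaR beta R i <= betaR beta R j)%MS.
  move=> /sub_rVP[a ji]; have a0 : a != 0.
    by apply: contra_neq (b0 j) => a0; rewrite ji a0 scale0r.
  by apply/sub_rVP; exists a^-1; rewrite ji scalerA mulVf // scale1r.
rewrite (partition_big l predT) //=; apply: big1 => s _.
have [[i <-]|no] := pselect (exists i, l i = s); last first.
  by rewrite big_pred0 // => i; apply/eqP => li; apply: no; exists i.
rewrite -[RHS](qs _ (b0 i)); last by exists i; exact: submx_refl.
apply: eq_bigl => j; apply/eqP/idP => [lji|ji].
  by have := submx_refl (betaR beta R j); move/setP/(_ j): lji; rewrite !inE => ->.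
by apply/setP => m; rewrite !inE; apply/idP/idP => h;
  apply: (submx_trans h) => //; exact: sub.
Qed.

End Weights.

(** * Nearest points between integral weights and the zonotope *)

(** The elements of [S] with value at most [f chi0] lie in a finite box, on which a minimum exists;
    all other elements have larger values. *)
Lemma int_row_argmin (R : realType) (k : nat) (S : set 'rV[int]_k)
    (f : 'rV[int]_k -> R) (chi0 : 'rV[int]_k) (B : R) :
  S chi0 ->
  (forall chi, S chi -> f chi <= f chi0 ->
     forall j, `|(chi 0 j)%:~R : R| <= B) ->
  exists2 chi, S chi & forall chi', S chi' -> f chi <= f chi'.
Proof.
(* The box of integers from [-n] to [n] in each coordinate is encoded by ordinals below [2n + 1],
   shifted by [n]. *)
move=> S0 bS; pose n := Num.bound B.
pose dec (u : 'rV['I_n.*2.+1]_k) : 'rV[int]_k := \row_j ((u 0 j : nat)%:Z - n%:Z).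
have decP chi : S chi -> f chi <= f chi0 -> exists u, chi = dec u.
  move=> Sc fc; exists (\row_j inord `|(chi 0 j + n%:Z)%R|%N).
  apply/rowP => j; rewrite !mxE.
  have : `|chi 0 j| <= n%:Z.
    rewrite -(ler_int R) intr_norm; apply: le_trans (bS _ Sc fc j) _.
    exact/ltW/archi_boundP/(le_trans _ (bS _ Sc fc j)).
  move=> cn; rewrite inordK; lia.
have [u0 u0E] := decP _ S0 (lexx _).
have P0 : `[< S (dec u0) >] by apply/asboolP; rewrite -u0E.
case: (@arg_minP _ R _ u0 (fun u => `[< S (dec u) >]) (f \o dec) P0) => u.
move=> /asboolP Su umin; exists (dec u) => // chi Sc.
have [fc|/ltW fc] := leP (f chi) (f chi0).
  have [v vE] := decP _ Sc fc.
  by rewrite vE; apply: umin; apply/asboolP; rewrite -vE.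
by apply: le_trans fc; rewrite u0E; exact: umin.
Qed.

Section Window.
Variables (R : realType) (N k : nat) (beta : 'M[int]_(N, k)).
Variable delta : 'rV[R]_k.

Local Notation b := (betaR beta R).

Definition zonotope_point (t : 'rV[R]_N) : 'rV[R]_k :=
  delta + 2^-1 *: \sum_i t 0 i *: b i.

(** The interval is kept as a set so that the cube is literally a product of compact sets. *)
Definition unit_cube : set 'rV[R]_N :=
  [set t : 'rV[R]_N | forall i, `[0, 1]%classic (t 0 i)].

Lemma unit_cubeP t : unit_cube t <-> forall i, 0 <= t 0 i <= 1.
Proof. by split=> t01 i; have := t01 i; rewrite /= in_itv. Qed.

Lemma nabla_atE p : nabla_at beta delta p <->
  exists2 t, unit_cube t & p = zonotope_point t.
Proof.
split=> [[_ [q qs <-] <-]|[t /unit_cubeP t01 ->]].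
  have /choice[t tP] i : exists t, 0 <= t <= 1 /\ t *: b i = q i.
    by have [t t01 <-] := qs i; exists t.
  exists (\row_i t i).
    by apply/unit_cubeP => i; rewrite mxE; have [] := tP i.
  rewrite /zonotope_point; congr (_ + _ *: _).
  by apply: eq_bigr => i _; rewrite mxE; have [] := tP i.
exists (2^-1 *: \sum_i t 0 i *: b i) => //.
by exists (fun i => t 0 i *: b i) => // i; exists (t 0 i) => //=.
Qed.

(** The squared distance is a continuous function of the parameter [t], which ranges over a compact
    cube. *)
Lemma zonotope_point_nearest (x : 'rV[R]_k) :
  exists2 t, unit_cube t & forall t', unit_cube t' ->
    dot (x - zonotope_point t) (x - zonotope_point t)
    <= dot (x - zonotope_point t') (x - zonotope_point t').
Proof.
pose f (t : 'rV[R]_N) := dot (x - zonotope_point t) (x - zonotope_point t).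
have cvgf (F : set_system 'rV[R]_N) (FF : Filter F) (t : 'rV[R]_N) :
    (forall i, (fun u : 'rV[R]_N => u 0 i) @ F --> t 0 i) -> f @ F --> f t.
  move=> Ft; have cj j : (fun u => (x - zonotope_point u) 0 j) @ F
      --> (x - zonotope_point t) 0 j.
    have E u : (x - zonotope_point u) 0 j
        = x 0 j - (delta 0 j + 2^-1 * \sum_i u 0 i * b i 0 j).
      by rewrite !mxE summxE; under eq_bigr do rewrite mxE.
    rewrite E; under eq_fun do rewrite E.
    apply: cvgB; first exact: cvg_cst.
    apply: cvgD; first exact: cvg_cst.
    apply: cvgM; first exact: cvg_cst.
    apply: cvg_big => [|i _]; first exact: add_continuous.
    by apply: cvgM; [exact: Ft | exact: cvg_cst].
  apply: cvg_big => [|j _]; first exact: add_continuous.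
  by apply: cvgM; exact: cj.
have cf : {within unit_cube, continuous f}.
  apply: continuous_subspaceT => t; apply: (cvgf _ (nbhs_filter t)) => i.
  exact: coord_continuous.
have [||t t01 tmin] := EVT_min_rV _ _ cf.
- by exists 0; apply/unit_cubeP => i; rewrite mxE lexx ler01.
- by apply: (@rV_compact R N (fun=> `[0, 1]%classic)) => i; exact: segment_compact.
by exists t => [|t' t'01]; [exact/set_mem | exact/tmin/mem_set].
Qed.

Lemma zonotope_point_bounded :
  exists B : R, forall t, unit_cube t -> forall j, `|zonotope_point t 0 j| <= B.
Proof.
exists (\sum_j (`|delta 0 j| + \sum_i `|b i 0 j|)) => t /unit_cubeP t01 j.
rewrite (bigD1 j) //= -[leLHS]addr0; apply: lerD; last first.
  by apply: sumr_ge0 => m _; rewrite addr_ge0 // sumr_ge0.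
rewrite mxE; apply: le_trans (ler_normD _ _) _; rewrite lerD2l.
rewrite mxE normrM summxE; apply: (@le_trans _ _ (1 * \sum_i `|b i 0 j|)); last first.
  by rewrite mul1r.
apply: ler_pM => //; first by rewrite ger0_norm; lra.
apply: le_trans (ler_norm_sum _ _ _) _; apply: ler_sum => i _.
have /andP[t0 t1] := t01 i.
by rewrite mxE normrM ger0_norm // ler_piMl.
Qed.

(* The squared distance from [muZ w] to the zonotope takes only finitely many
   values below a given one, since [muZ w] is integral. *)
Lemma nearest_weight (F : set 'rV[int]_N) : F !=set0 ->
  exists w t, [/\ F w, unit_cube t &
    forall w' t', F w' -> unit_cube t' ->
    let v := toR R (muZ beta w) - zonotope_point t in
    let v' := toR R (muZ beta w') - zonotope_point t' in dot v v <= dot v' v'].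
Proof.
move=> [w0 Fw0].
have /choice[t tP] chi : exists t, unit_cube t /\ forall t', unit_cube t' ->
    let v := toR R chi - zonotope_point t in
    let v' := toR R chi - zonotope_point t' in dot v v <= dot v' v'.
  by have [t t1 t2] := zonotope_point_nearest (toR R chi); exists t.
pose v chi := toR R chi - zonotope_point (t chi).
have [B BP] := zonotope_point_bounded.
(* If the squared distance is at most [d], each coordinate of the difference is at most [d + 1] in
   absolute value, which avoids a square root; [B] bounds the coordinates of the zonotope. *)
have [||_ [w Fw <-] wmin] := @int_row_argmin R k (muZ beta @` F)
  (fun chi => dot (v chi) (v chi)) (muZ beta w0)
  (B + dot (v (muZ beta w0)) (v (muZ beta w0)) + 1); first by exists w0.
  move=> chi _ /=; set d := dot (v (muZ beta w0)) _ => le_d j.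
  have [tc _] := tP chi; have := BP _ tc j.
  have := le_trans (sqr_coord_le_dot (v chi) j) le_d.
  have -> : (chi 0 j)%:~R = v chi 0 j + zonotope_point (t chi) 0 j.
    by rewrite !mxE; ring.
  have := ler_normD (v chi 0 j) (zonotope_point (t chi) 0 j).
  set a := v chi 0 j; set q := zonotope_point _ _ _ => h1 h2 h3.
  have : `|a| ^+ 2 <= d by rewrite real_normK ?num_real.
  have := normr_ge0 a => h4 h5.
  have : `|a| <= d + 1 by nra.
  by lra.
exists w, (t (muZ beta w)); split=> //; first by have [] := tP (muZ beta w).
move=> w' t' Fw' t'01 /=.
apply: le_trans (wmin _ (imageP _ Fw')) _.
by have [_] := tP (muZ beta w'); apply.
Qed.

(* First-order optimality: a nearest point of the zonotope maximises the linear
   form [dot (x - zonotope_point t)] on it. *)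
Lemma nearest_coord (x : 'rV[R]_k) (t : 'rV[R]_N) :
  unit_cube t ->
  (forall t', unit_cube t' ->
    dot (x - zonotope_point t) (x - zonotope_point t)
    <= dot (x - zonotope_point t') (x - zonotope_point t')) ->
  forall i, (0 < dot (x - zonotope_point t) (b i) -> t 0 i = 1) /\
            (dot (x - zonotope_point t) (b i) < 0 -> t 0 i = 0).
Proof.
move=> /unit_cubeP t01 tmin i; set l := x - zonotope_point t.
(* Changing the coordinate [t 0 i] by [s] moves the zonotope point by [s / 2] times [b i], and this
   cannot reduce the distance. *)
have step s : 0 <= t 0 i + s <= 1 ->
    s * dot l (b i) <= s ^+ 2 * dot (b i) (b i) / 4.
  move=> s01; pose t' := t + s *: delta_mx 0 i.
  have t'01 : unit_cube t'.
    apply/unit_cubeP => j; rewrite !mxE /=.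
    by have [->|_] := eqVneq j i; rewrite ?mulr1 // mulr0 addr0.
  have -> : s * dot l (b i) = dot l l + s * dot l (b i) - dot l l by ring.
  rewrite lerBlDr; have := tmin _ t'01; rewrite -/l.
  have -> : x - zonotope_point t' = l - (s / 2) *: b i.
    rewrite /l /zonotope_point; have -> : \sum_j t' 0 j *: b j
        = \sum_j t 0 j *: b j + s *: b i.
      rewrite /t'; under eq_bigr do rewrite !mxE /= scalerDl.
      rewrite big_split /=; congr (_ + _).
      rewrite (bigD1 i) //= eqxx mulr1 big1 ?addr0 //.
      by move=> j ji; rewrite (negPf ji) mulr0 scale0r.
    by rewrite scalerDr scalerA [2^-1 * s]mulrC addrA opprD addrA.
  by rewrite dot_sqrB => h; clear -h; lra.
have g0 := dot_ge0 (b i); have /andP[t0 t1] := t01 i.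
split=> c0; apply/eqP; apply: contraT => ti.
  (* The first bound keeps the parameter in the cube; the second makes the linear gain exceed the
     quadratic loss. The added 1 keeps the denominator positive. *)
  pose s := Num.min (1 - t 0 i) (dot l (b i) / (dot (b i) (b i) + 1)).
  have s0 : 0 < s by rewrite lt_min subr_gt0 lt_neqAle ti t1 divr_gt0 //; lra.
  have s1 : s <= 1 - t 0 i by rewrite ge_min lexx.
  have s2 : s * (dot (b i) (b i) + 1) <= dot l (b i).
    by rewrite -ler_pdivlMr; [rewrite ge_min lexx orbT | lra].
  have := step s; rewrite addr_ge0 ?(ltW s0) // -lerBrDl s1 => /(_ isT).
  rewrite expr2 -!mulrA ler_pM2l // => h; clear -h g0 s0 s2; nra.
pose s := Num.min (t 0 i) (- dot l (b i) / (dot (b i) (b i) + 1)).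
have s0 : 0 < s.
  by rewrite lt_min lt_neqAle eq_sym ti t0 divr_gt0 ?oppr_gt0 //; lra.
have s1 : s <= t 0 i by rewrite ge_min lexx.
have s2 : s * (dot (b i) (b i) + 1) <= - dot l (b i).
  by rewrite -ler_pdivlMr; [rewrite ge_min lexx orbT | lra].
have := step (- s); rewrite subr_ge0 s1 /= => /(_ ltac:(lra)).
rewrite sqrrN expr2 mulNr -mulrN -!mulrA ler_pM2l // => h; clear -h g0 s0 s2; nra.
Qed.

(* By quasi-symmetry the zonotope is at least as long as [b i] in the direction
   of [b i], so the face where [dot l] is maximal can be pushed by [b i]
   towards the opposite face. *)
Lemma zonotope_point_shift (l : 'rV[R]_k) (t : 'rV[R]_N) (i : 'I_N) :
  quasi_symmetric beta R -> b i != 0 -> dot l (b i) != 0 -> unit_cube t ->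
  (forall j, (0 < dot l (b j) -> t 0 j = 1) /\
             (dot l (b j) < 0 -> t 0 j = 0)) ->
  exists2 t', unit_cube t' &
    zonotope_point t' = zonotope_point t - Num.sg (dot l (b i)) *: b i.
Proof.
move=> qs bi0 li0 /unit_cubeP t01 tl.
pose L j := (b j <= b i)%MS.
have /choice[c cP] j : exists c, L j -> b j = c *: b i.
  have [/sub_rVP[c cE]|] := boolP (L j); last by exists 0.
  by exists c.
have bL : \sum_(j | L j) b j = 0 by apply: qs => //; exists i; exact: submx_refl.
have cL : \sum_(j | L j) c j = 0.
  have : (\sum_(j | L j) c j) *: b i = 0.
    by rewrite -[RHS]bL scaler_suml; apply: eq_bigr => j /cP.
  by move/eqP; rewrite scaler_eq0 (negPf bi0) orbF => /eqP.
have Li : L i by exact: submx_refl.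
have ci : c i = 1.
  have := cP _ Li; rewrite -{1}[b i]scale1r => /eqP.
  by rewrite -subr_eq0 -scalerBl scaler_eq0 (negPf bi0) orbF subr_eq0 => /eqP.
(* On the line of [b i], maximality makes [T] the sum of the [c j] of one sign: the positive ones if
   [dot l (b i)] is positive, the negative ones otherwise. These two sums are opposite, and
   [c i = 1] makes their absolute value at least 1. *)
pose T := \sum_(j | L j) t 0 j * c j.
have TE : T = \sum_(j | L j) (t 0 j - 1) * c j.
  rewrite /T; under [RHS]eq_bigr do rewrite mulrBl mul1r.
  by rewrite sumrB cL subr0.
have lc j : L j -> dot l (b j) = c j * dot l (b i).
  by move=> /cP->; rewrite dotZr.
have sgT : Num.sg T = Num.sg (dot l (b i)) /\ 1 <= `|T|.
  have := li0; rewrite neq_lt => /orP[li|li].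
    have T1 : T <= -1.
      rewrite TE (bigD1 i) //= (proj2 (tl i) li) ci sub0r mulr1 -[leRHS]addr0.
      rewrite lerD2l; apply: sumr_le0 => j /andP[Lj _].
      have /andP[t0 t1] := t01 j.
      have [cj|cj] := leP 0 (c j); first by rewrite mulr_le0_ge0 // subr_le0.
      by rewrite (proj1 (tl j)) ?subrr ?mul0r // lc // nmulr_rgt0.
    rewrite !ltr0_sg //; last by apply: le_lt_trans T1 _; rewrite oppr_lt0.
    by rewrite ler0_norm; lra.
  have T1 : 1 <= T.
    rewrite /T (bigD1 i) //= (proj1 (tl i) li) ci mulr1 lerDl.
    apply: sumr_ge0 => j /andP[Lj _]; have /andP[t0 t1] := t01 j.
    have [cj|cj] := leP 0 (c j); first by rewrite mulr_ge0.
    by rewrite (proj2 (tl j)) ?mul0r // lc // pmulr_llt0.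
  by rewrite !gtr0_sg ?ger0_norm //; lra.
case: sgT => <- T1; pose s := `|T|^-1.
have T0 : `|T| != 0 by rewrite gt_eqF //; lra.
have s01 : 0 <= s <= 1 by rewrite invr_ge0 normr_ge0 invf_le1 //; lra.
(* On the line, [t'] moves the fraction [s] of the way from [t] to its reflection [1 - t]. As the
   [c j] sum to zero, the full reflection would shift the point by [- T *: b i], and [s] normalises
   this to one step. *)
pose t' := \row_j (t 0 j + if L j then s * (1 - 2 * t 0 j) else 0).
exists t'.
  apply/unit_cubeP => j; rewrite mxE; have := t01 j.
  by case: (L j) => h; [clear -h s01; nra | rewrite addr0].
rewrite /zonotope_point -addrA; congr (_ + _).
under eq_bigr do rewrite mxE scalerDl.
rewrite big_split scalerDr /=; congr (_ + _).
have -> : \sum_j (if L j then s * (1 - 2 * t 0 j) else 0) *: b j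
    = \sum_(j | L j) (s * (c j - 2 * (t 0 j * c j))) *: b i.
  rewrite [RHS]big_mkcond; apply: eq_bigr => j _.
  case: ifP => [/cP->|_]; last by rewrite scale0r.
  by rewrite scalerA; congr (_ *: _); ring.
rewrite -scaler_suml -mulr_sumr sumrB cL -mulr_sumr -/T scalerA -[RHS]scaleNr.
congr (_ *: _); rewrite {1}[T]numEsg /s; field; exact: T0.
Qed.

End Window.

(** * Comparison of the window, chamber and FLTZ skeleta *)

Section Skeleta.
Variables (R : realType) (N k : nat) (beta : 'M[int]_(N, k)).
Variable delta : 'rV[R]_k.

Local Notation b := (betaR beta R).

Lemma dot_zonotope_point (l : 'rV[R]_k) t :
  dot l (zonotope_point beta delta t)
  = dot l delta + 2^-1 * \sum_i t 0 i * dot l (b i).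
Proof.
rewrite dotDr dotZr dot_sumr; congr (_ + _ * _).
by apply: eq_bigr => i _; rewrite dotZr.
Qed.

Lemma window_weight_exists (C : set 'rV[R]_k) (I : {set 'I_N}) (x : 'rV[R]_N) :
  (forall i, row i beta != 0) -> quasi_symmetric beta R -> gkz_chamber beta C ->
  index_sets beta C I -> chamber_core beta delta C (muR beta x) ->
  (forall i, i \notin I -> x 0 i \is a Num.int) ->
  exists w : 'rV[int]_N, [/\ window beta delta (muZ beta w),
    forall i, (w 0 i)%:~R <= x 0 i &
    forall i, i \notin I -> (w 0 i)%:~R = x 0 i].
Proof.
move=> beta0 qs hC [y [/= Cy /RIposE[y0 yI]]] xC xint.
pose F := [set w : 'rV[int]_N | (forall i, (w 0 i)%:~R <= x 0 i) /\
  (forall i, i \notin I -> (w 0 i)%:~R = x 0 i)].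
have F0 : F !=set0.
  exists (\row_i Num.floor (x 0 i)); split=> i; rewrite mxE ?floor_le //.
  by move=> /xint/floorK.
have [w [t [Fw t01 wtmin]]] := nearest_weight beta delta F0.
set l := toR R (muZ beta w) - zonotope_point beta delta t.
have tl := nearest_coord t01 (fun t' => wtmin w t' Fw).
rewrite -/l in tl.
have bi0 i : b i != 0.
  apply: contra_neq (beta0 i) => /rowP bi; apply/rowP => j.
  by have := bi j; rewrite !mxE => /eqP; rewrite intr_eq0 => /eqP.
have no_shift i : dot l (b i) != 0 ->
    ~ F (w - sgz (dot l (b i)) *: delta_mx 0 i).
  move=> li0 Fw'; set w' := w - _ in Fw'.
  have [t' t'01 zt'] := zonotope_point_shift delta qs (bi0 i) li0 t01 tl.
  have lE : toR R (muZ beta w') - zonotope_point beta delta t' = l.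
    have -> : toR R (muZ beta w') = toR R (muZ beta w) - Num.sg (dot l (b i)) *: b i.
      by rewrite sgrEz /w' /muZ mulmxBl -scalemxAl -rowE /toR map_mxB map_mxZ map_row.
    by rewrite zt' opprB addrA subrK.
  have min' := fun t'' => wtmin w' t'' Fw'; rewrite /= -/l -{1 2}lE in min'.
  have t'l := nearest_coord t'01 min'; rewrite lE in t'l.
  (* First-order optimality forces [t] and [t'] to agree at every coordinate where [dot l (b j)] is
     nonzero. *)
  have : dot l (zonotope_point beta delta t') = dot l (zonotope_point beta delta t).
    rewrite !dot_zonotope_point; congr (_ + _ * _); apply: eq_bigr => j _.
    have [lj|lj|->] := ltgtP (dot l (b j)) 0; last by rewrite !mulr0.
      by rewrite (proj2 (tl j)) // (proj2 (t'l j)).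
    by rewrite (proj1 (tl j)) // (proj1 (t'l j)).
  move/eqP; rewrite zt' dotBr dotZr -subr_eq0 addrAC subrr add0r oppr_eq0.
  by rewrite mulf_eq0 sgr_eq0 orbb (negPf li0).
have lI i : i \in I -> dot l (b i) <= 0.
  move=> iI; rewrite leNgt; apply/negP => li.
  apply: (no_shift i); first exact: lt0r_neq0.
  case: Fw => wx wI; rewrite gtr0_sgz // scale1r; split=> j; last first.
    move=> jI; rewrite !mxE /= (_ : (j == i) = false) ?subr0 ?wI //.
    by apply: contraNF jI => /eqP->.
  rewrite !mxE /= rmorphB /=; apply: le_trans (wx j).
  by rewrite gerBl; case: (j == i); rewrite ?ler0z.
have uI i : i \in I -> dot l (b i) < 0 -> x 0 i - (w 0 i)%:~R <= 1.
  move=> iI li; rewrite leNgt; apply/negP => xw.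
  apply: (no_shift i); first exact: ltr0_neq0.
  case: Fw => wx wI; rewrite ltr0_sgz // scaleN1r opprK; split=> j; last first.
    move=> jI; rewrite !mxE /= (_ : (j == i) = false) ?addr0 ?wI //.
    by apply: contraNF jI => /eqP->.
  rewrite !mxE /= rmorphD /=; have [->|_] := eqVneq j i; last by rewrite addr0.
  by rewrite -lerBrDl ltW.
exists w; have [wx wI] := Fw; split => //.
apply/nabla_atE; exists t => //; apply/eqP; rewrite -subr_eq0 -/l.
apply: contraT => /dot_gt0 l0.
pose neg i := Num.min 0 (dot l (b i)).
(* The vertex of the cube at which the form [l] is smallest on the zonotope. *)
pose tm : 'rV[R]_N := \row_i (dot l (b i) < 0)%R%:R.
have tm01 : unit_cube tm.
  by apply/unit_cubeP => i; rewrite mxE; case: (_ < 0); rewrite lexx ler01.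
have ltm : dot l (zonotope_point beta delta tm) = dot l delta + 2^-1 * \sum_i neg i.
  rewrite dot_zonotope_point; congr (_ + _ * _); apply: eq_bigr => i _.
  rewrite mxE /neg; case: ltP => li; first by rewrite mul1r.
  by rewrite mul0r.
(* The weights sum to zero, so the positive parts of [dot l (b i)] add up to the opposite of the
   negative parts. *)
have lt : dot l (zonotope_point beta delta t) = dot l delta - 2^-1 * \sum_i neg i.
  rewrite dot_zonotope_point -mulrN; congr (_ + _ * _).
  apply/eqP; rewrite -addr_eq0 -big_split /= -[X in _ == X](dot0r l).
  rewrite -(sum_betaR_eq0 beta0 qs) dot_sumr; apply/eqP/eq_bigr => i _.
  have := tl i; rewrite /neg; case: ltgtP => li [h1 h2].
  - by rewrite h1 // mul1r addr0.
  - by rewrite h2 // mul0r add0r.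
  - by rewrite -li mulr0 addr0.
have lx : dot l (muR beta x) <= dot l (zonotope_point beta delta tm).
  have [|c Cc <-] := xC (zonotope_point beta delta tm).
    by apply/nabla_atE; exists tm.
  rewrite dotDr gerDl; apply: (chamber_dot_le0 hC Cy) Cc => i.
    by have [/y0/ltW|/yI->] := boolP (i \in I).
  by have [/lI|/yI->] := boolP (i \in I); rewrite ?eqxx.
(* Only indices of [I] with [dot l (b i)] negative contribute, and there [x 0 i - w 0 i] lies
   between 0 and 1. *)
have lu : \sum_i neg i <= dot l (muR beta x) - dot l (toR R (muZ beta w)).
  rewrite -dotBr toR_muZ {1 2}/muR -mulmxBl -/(muR beta _) muR_sum dot_sumr.
  apply: ler_sum => i _; rewrite dotZr !mxE /neg.
  have [iI|/wI->] := boolP (i \in I); last by rewrite subrr mul0r ge_min lexx.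
  have := lI i iI; have := uI i iI; have := wx i; case: ltgtP => //.
    move=> li wxi /(_ isT) xw _; rewrite -subr_ge0 in wxi; nra.
  by move=> -> _ _ _; rewrite mulr0.
(* The width of the zonotope along [l] is minus the sum of [neg]. Hence [lu] places [muR beta x] at
   least [dot l l] above the minimum, against [lx]. *)
have : dot l (toR R (muZ beta w)) = dot l (zonotope_point beta delta t) + dot l l.
  by rewrite -dotDr; congr dot; rewrite /l addrC subrK.
by move: l0 ltm lt lx lu; lra.
Qed.

Lemma Lambda_chamberE (C : set 'rV[R]_k) z :
  Lambda_chamber beta C z <->
  exists I, [/\ index_sets beta C I,
    forall i, i \notin I -> z.1 0 i \is a Num.int,
    forall i, i \in I -> z.2 0 i = 0 &
    forall i, i \notin I -> z.2 0 i <= 0].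
Proof.
split=> [[I CI [[_ [w _ <-]] [y /RIE yI zE] [xi /RInnegE[xi0 xiI] xiE]]]|].
  exists I; split=> // i iI.
  - by rewrite -zE mxE yI // addr0 mxE intr_int.
  - by rewrite -xiE mxE xiI ?oppr0 // inE negbK.
  - by rewrite -xiE mxE oppr_le0 xi0 // inE.
move=> [I [CI zint zI z0]]; exists I => //; split.
  exists (toR R (\row_i Num.floor (z.1 0 i))); first by eexists.
  exists (z.1 - toR R (\row_i Num.floor (z.1 0 i))); last by rewrite addrC subrK.
  by apply/RIE => i /zint/floorK zi; rewrite !mxE zi subrr.
exists (- z.2); last by rewrite opprK.
apply/RInnegE; split=> i; rewrite inE ?negbK mxE.
  by rewrite oppr_ge0 => /z0.
by move=> /zI->; rewrite oppr0.
Qed.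

Lemma Lambda_window_chamber (C : set 'rV[R]_k) z :
  (forall i, row i beta != 0) -> quasi_symmetric beta R -> gkz_chamber beta C ->
  chamber_core beta delta C (muR beta z.1) ->
  Lambda_window beta delta z <-> Lambda_chamber beta C z.
Proof.
move=> beta0 qs hC zC; rewrite Lambda_chamberE; split.
  (* With [I] the set of strict inequalities, [z.1 - w] lies in the open cone of [I]. Its weight is
     in [C] because the weight of [w] is one of the points [p] over which the core is
     intersected. *)
  move=> [w Ww wz]; exists [set i | (w 0 i)%:~R < z.1 0 i]%SET; split.
  - exists (z.1 - toR R w); split.
      have [c Cc cE] := zC _ Ww.
      by rewrite /= /muR mulmxBl -/(muR beta z.1) -cE toR_muZ addrC addKr.
    apply/RIposE; split=> i; rewrite inE !mxE ?subr_gt0 //.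
    by have [[->]|[-> _]] := wz i; rewrite ?subrr.
  - move=> i; rewrite inE; have [[->]//|[-> _] _] := wz i; exact: intr_int.
  - by move=> i; rewrite inE; have [[_ ->]|[->]] := wz i; rewrite ?ltxx.
  - by move=> i; rewrite inE; have [[->]|[]] := wz i.
move=> [I [CI zint zI z0]].
have [w [Ww wz wI]] := window_weight_exists beta0 qs hC CI zC zint.
(* A strict inequality at [i] forces [i] into [I], where the covector vanishes. *)
exists w => // i; have := wz i; rewrite le_eqVlt => /predU1P[wi|wi].
  right; split=> //; have [/zI->//|/z0//] := boolP (i \in I).
left; split=> //; apply: zI; apply: contraLR wi => /wI->.
by rewrite ltxx.
Qed.

Lemma alphaE (i : 'I_N) (m : subvs_of (MR beta R)) : alpha beta R i m = vsval m 0 i.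
Proof.
rewrite nuRE (bigD1 i) //= mxE !eqxx mul1r big1 ?addr0 // => j ji.
by rewrite mxE eqxx (negPf ji) mul0r.
Qed.

Lemma nuRN (xi : 'rV[R]_N) : nuR beta (- xi) = - nuR beta xi.
Proof.
apply/lfunP => m; rewrite opp_lfunE !nuRE -sumrN.
by apply: eq_bigr => i _; rewrite mxE mulNr.
Qed.

(** The lifted FLTZ skeleton is the restriction of the chamber skeleton to the fibre through [w0].
    Each [alpha i] reads off the [i]-th coordinate, and translation by the integral [w0] preserves
    integrality. *)
Lemma FLTZ_coverE (C : set 'rV[R]_k) (w0 : 'rV[int]_N)
    (m : subvs_of (MR beta R)) (eta : NR beta R) :
  FLTZ_cover C (m, eta) <->
  exists2 xi, Lambda_chamber beta C (toR R w0 + vsval m, xi) & nuR beta xi = eta.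
Proof.
have shift i : ((toR R w0 + vsval m) 0 i \is a Num.int) = (vsval m 0 i \is a Num.int).
  by rewrite !mxE rpredDl // intr_int.
split=> [[I CI [/= mI [_ [xi /RInnegE[xi0 xiI] <-] <-]]]|].
  exists (- xi); last exact: nuRN.
  apply/Lambda_chamberE; exists I; split=> //= i iI.
  - by rewrite shift -alphaE mI // inE.
  - by rewrite mxE xiI ?oppr0 // inE negbK.
  - by rewrite mxE oppr_le0 xi0 // inE.
move=> [xi /Lambda_chamberE[I [CI mI xiI xi0]] <-]; exists I => //; split=> /=.
  by move=> i; rewrite inE alphaE -shift => /mI.
exists (nuR beta (- xi)); last by rewrite nuRN opprK.
exists (- xi) => //; apply/RInnegE; split=> i; rewrite inE ?negbK mxE.
  by rewrite oppr_ge0 => /xi0.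
by move=> /xiI->; rewrite oppr0.
Qed.

End Skeleta.

Theorem theorem1p4 (R : realType) (N k : nat) (beta : 'M[int]_(N, k))
  (mu_surj : forall chi : 'rV[int]_k, exists w : 'rV[int]_N, muZ beta w = chi)
  (beta_neq0 : forall i : 'I_N, row i beta != 0)
  (beta_span : row_full (toR R beta))
  (beta_qs : quasi_symmetric beta R)
  (delta : 'rV[R]_k) (C : set 'rV[R]_k) (hC : gkz_chamber beta C) :
  (Lambda_window beta delta
     `&` cotangent (muR beta @^-1` chamber_core beta delta C)
   = Lambda_chamber beta C
     `&` cotangent (muR beta @^-1` chamber_core beta delta C))
  /\
  (forall l : 'rV[int]_k, chamber_core beta delta C (toR R l) ->
   forall w0 : 'rV[int]_N, muZ beta w0 = l ->
     Lambda_bar beta delta l w0 = FLTZ beta C).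
Proof.
split=> [|l lC w0 w0l].
  apply/seteqP; split=> z [zL zC]; split=> //;
    by apply/(Lambda_window_chamber beta_neq0 beta_qs hC zC).
(* Both sides are quotients by the lattice, so their lifts are compared; over [l] the whole fibre
   lies above the core, where the first part applies. *)
congr mod_M; apply/seteqP; split=> [[m eta] /=|[m eta]].
  move=> [[x xi] [/= zL zl] [xE <-]]; apply/(FLTZ_coverE _ w0); exists xi => //.
  have xC : chamber_core beta delta C (muR beta (x, xi).1) by rewrite /= zl.
  by rewrite -xE; apply/(Lambda_window_chamber beta_neq0 beta_qs hC xC).
move=> /(FLTZ_coverE _ w0)[xi zL <-].
have ml : muR beta (toR R w0 + vsval m) = toR R l.
  rewrite /muR mulmxDl -/(muR beta _) -toR_muZ w0l.
  by have := subvsP m; rewrite mem_MR => /eqP; rewrite /muR => ->; rewrite addr0.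
exists (toR R w0 + vsval m, xi) => //; split=> //=.
by apply/(Lambda_window_chamber beta_neq0 beta_qs hC); rewrite //= ml.
Qed.
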